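(* Let $(G,\star,g)$ be a log-Euclidean Lie group equipped with a log-Euclidean metric $g$, and let $H$ be a connected closed subgroup of $G$. Let $s:G/H\to G$ be the canonical section of $\pi:G\to G/H$ and denote its image by $K=s(G/H)$. Then the map $$\Phi:(H,g|_H)\times(K,g|_K)\longrightarrow(G,g),\qquad(h,k)\longmapsto h\star k$$ is a Riemannian isometry (for the product metric on the source). Thus $(G,g)$ splits as an orthogonal internal direct product of $(H,g|_H)$ and $(K,g|_K)$, that is, $g=g|_H+g|_K$ under $\Phi$.
   Context: A log-Euclidean Lie group is a smooth manifold $G$ with a diffeomorphism $\log_G:G\to\mathfrak g$ onto a finite-dimensional real vector space $\mathfrak g$ (identified with the Lie algebra $T_{e_G}G$), with inverse $\exp_G$, equipped with the commutative Lie group law $u\star v=\exp_G(\log_G(u)+\log_G(v))$. A log-Euclidean metric is $g=\log_G^*\langle\cdot,\cdot\rangle$ for an inner product $\langle\cdot,\cdot\rangle$ on $\mathfrak g$. $\mathfrak h=\log_G(H)$ is a linear subspace of $\mathfrak g$ and $\mathfrak m:=\mathfrak h^\perp$ is its orthogonal complement. The canonical section is $s([p])=\exp_G(s_{\mathrm{lin}}(\log_G(p)+\mathfrak h))$, where $s_{\mathrm{lin}}:\mathfrak g/\mathfrak h\to\mathfrak m$ is the inverse of the linear isomorphism $\mathfrak m\to\mathfrak g/\mathfrak h$, $X\mapsto X+\mathfrak h$. $g|_H,g|_K$ denote the metrics induced by $g$ on the submanifolds $H,K$. *)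

(* Defs.v *)
From HB Require Import structures.
From mathcomp Require Import all_boot all_order all_algebra.
From mathcomp Require Import all_classical all_reals all_analysis.

Set Implicit Arguments.
Unset Strict Implicit.
Unset Printing Implicit Defensive.

Import Order.TTheory GRing.Theory Num.Theory.
Import numFieldNormedType.Exports.

Local Open Scope classical_set_scope.
Local Open Scope ring_scope.

(* Finite-dimensional normed real vector spaces. All norms on such a space are
   equivalent, so the norm only serves to name the canonical topology. *)
#[short(type="normedVectType")]
HB.structure Definition NormedVect (R : numFieldType) :=
  {V of Vector R V & NormedModule R V}.

Section SmoothManifolds.
Context {R : realType}.

(* C^k on an open set U of a finite-dimensional space: all iterated directional
   derivatives of order < k are differentiable on U, those of order k are
   continuous on U. *)
Fixpoint Ck (k : nat) (V W : normedModType R) (U : set V) (f : V -> W) : Prop :=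
  if k is k'.+1 then
    (forall x, U x -> differentiable f x) /\ (forall v, Ck k' U ('D_v f))
  else forall x, U x -> {for x, continuous f}.

Definition Coo (V W : normedModType R) (U : set V) (f : V -> W) : Prop :=
  forall k, Ck k U f.

(* The inverse is a total function, relevant only on [c @` chart_dom c]. *)
Record chart (M : topologicalType) (E : normedModType R) := Chart {
  chart_dom : set M ;
  chart_map :> M -> E ;
  chart_inv : E -> M }.

Definition is_chart (M : topologicalType) (E : normedModType R)
    (c : chart M E) : Prop :=
  [/\ open (chart_dom c),
      open (c @` chart_dom c),
      forall p, chart_dom c p -> chart_inv c (c p) = p,
      forall p, chart_dom c p -> {for p, continuous c} &
      forall x, (c @` chart_dom c) x -> {for x, continuous (chart_inv c)}].

Definition compatible (M : topologicalType) (E : normedModType R)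
    (c d : chart M E) : Prop :=
  Coo (c @` (chart_dom c `&` chart_dom d)) (d \o chart_inv c) /\
  Coo (d @` (chart_dom c `&` chart_dom d)) (c \o chart_inv d).

(* [chart_at p] is a preferred chart around p, through which the tangent space
   at p is identified with the model space E. *)
Record chartedSpace (E : normedModType R) := ChartedSpace {
  carrier :> topologicalType ;
  atlas : set (chart carrier E) ;
  chart_at : carrier -> chart carrier E }.

Definition smooth_manifold (E : normedModType R) (M : chartedSpace E) : Prop :=
  [/\ hausdorff_space M,
      @second_countable M,
      forall c, atlas (c : chart M E) -> is_chart c,
      forall c d, atlas (c : chart M E) -> atlas d -> compatible c d &
      forall p : M, atlas (chart_at p) /\ chart_dom (chart_at p) p].

Definition id_chart (E : normedModType R) : chart E E := Chart setT id id.

Definition model_space (E : normedModType R) : chartedSpace E :=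
  ChartedSpace [set id_chart E] (fun=> id_chart E).

Definition prod_chart (M N : topologicalType) (E F : normedModType R)
    (c : chart M E) (d : chart N F) : chart (M * N)%type (E * F)%type :=
  Chart (chart_dom c `*` chart_dom d)
        (fun p => (c p.1, d p.2))
        (fun x => (chart_inv c x.1, chart_inv d x.2)).

Definition prod_space (E F : normedModType R) (M : chartedSpace E)
    (N : chartedSpace F) : chartedSpace (E * F)%type :=
  @ChartedSpace _ (M * N)%type
    [set e | exists c d, [/\ atlas (c : chart M E), atlas (d : chart N F) &
                             e = prod_chart c d]]
    (fun p => prod_chart (chart_at p.1) (chart_at p.2)).

(* C^oo on a neighbourhood of p. *)
Definition smooth_at (E F : normedModType R) (M : chartedSpace E)
    (N : chartedSpace F) (f : M -> N) (p : M) : Prop :=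
  {for p, continuous f} /\
  forall (c : chart M E) (d : chart N F), atlas c -> atlas d ->
    chart_dom c p -> chart_dom d (f p) ->
    exists2 U, open_nbhs (c p) U & Coo U (d \o f \o chart_inv c).

(* The differential T_pM -> T_(f p)N, read in the preferred charts. *)
Definition mdiff (E F : normedModType R) (M : chartedSpace E)
    (N : chartedSpace F) (f : M -> N) (p : M) : E -> F :=
  'd (chart_at (f p) \o f \o chart_inv (chart_at p)) (chart_at p p).

(* Smoothness on a subset: local extendability to a smooth map on the ambient
   manifold; on an embedded submanifold this is smoothness for its own
   manifold structure. *)
Definition smooth_on (E F : normedModType R) (M : chartedSpace E)
    (N : chartedSpace F) (A : set M) (f : M -> N) : Prop :=
  forall p, A p -> exists U (f' : M -> N),
    [/\ open_nbhs p U, forall q, U q -> smooth_at f' q &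
        forall q, U q -> A q -> f' q = f q].

Definition diffeomorphism (E F : normedModType R) (M : chartedSpace E)
    (N : chartedSpace F) (A : set M) (B : set N) (f : M -> N) : Prop :=
  [/\ set_bij A B f, smooth_on A f &
      exists2 f' : N -> M, smooth_on B f' & forall p, A p -> f' (f p) = p].

Section Submanifolds.
Context {E : normedModType R} (M : chartedSpace E).

Definition linear_subspace (V : lmodType R) (L : set V) : Prop :=
  L 0 /\ forall (a : R) x y, L x -> L y -> L (a *: x + y).

(* Slice charts: around each of its points, A is the linear subspace L of the
   model space in a chart of the maximal atlas. *)
Definition embedded_submanifold (A : set M) : Prop :=
  exists2 L : set E, linear_subspace L &
    forall p, A p -> exists c : chart M E,
      [/\ is_chart c, forall d, atlas d -> compatible c d, chart_dom c p &
          c @` (A `&` chart_dom c) = L `&` (c @` chart_dom c)].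

(* Germs at 0 of smooth curves in A starting at p. *)
Definition curves (A : set M) (p : M) : set (R -> M) :=
  [set gamma | [/\ gamma 0 = p,
                   smooth_at (M := model_space R) gamma 0 &
                   \forall t \near (0 : R), A (gamma t)]].

Definition velocity (gamma : R -> M) : E :=
  mdiff (M := model_space R) gamma 0 1.

(* T_pA as a subset of T_pM. *)
Definition tangent (A : set M) (p : M) : set E :=
  [set velocity gamma | gamma in curves A p].

Definition metric_tensor := M -> E -> E -> R.

(* The metric induced by g on A; it is only meaningful at points of A and on
   vectors tangent to A, and is given the value 0 elsewhere. *)
Definition induced_metric (A : set M) (g : metric_tensor) : metric_tensor :=
  fun p X Y =>
    if `[< [/\ A p, tangent A p X & tangent A p Y] >] then g p X Y else 0.

End Submanifolds.

Definition prod_metric (E F : normedModType R) (M : chartedSpace E)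
    (N : chartedSpace F) (g : metric_tensor M) (h : metric_tensor N) :
    metric_tensor (prod_space M N) :=
  fun p X Y => g p.1 X.1 Y.1 + h p.2 X.2 Y.2.

(* f is an isometry of the submanifold A with metric g onto the submanifold B
   with metric h. As f is only relevant on A, its differential is computed
   along curves in A. *)
Definition riemannian_isometry (E F : normedModType R) (M : chartedSpace E)
    (N : chartedSpace F) (A : set M) (g : metric_tensor M) (B : set N)
    (h : metric_tensor N) (f : M -> N) : Prop :=
  diffeomorphism A B f /\
  forall p (gamma delta : R -> M),
    A p -> curves A p gamma -> curves A p delta ->
    h (f p) (velocity (f \o gamma)) (velocity (f \o delta)) =
    g p (velocity gamma) (velocity delta).

End SmoothManifolds.

Record logEuclideanGroup (R : realType) := LogEuclideanGroup {
  lie_alg : normedVectType R ;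
  manifold :> chartedSpace 'rV[R]_(dim lie_alg) ;
  logG : manifold -> lie_alg ;
  expG : lie_alg -> manifold ;
  manifoldP : smooth_manifold manifold ;
  logGK : cancel logG expG ;
  expGK : cancel expG logG ;
  logG_smooth : forall u, smooth_at (M := manifold) (N := model_space lie_alg) logG u ;
  expG_smooth : forall x, smooth_at (M := model_space lie_alg) (N := manifold) expG x }.

Section LogEuclidean.
Context {R : realType} (G : logEuclideanGroup R).
Local Notation lie := (lie_alg G).
Implicit Types (u v : G) (H K : set G) (ip : lie -> lie -> R).

Definition lmul u v : G := expG (logG u + logG v).
Definition lone : G := expG (0 : lie).
Definition linv u : G := expG (- logG u).

Definition subgroup H : Prop :=
  [/\ H lone, forall u v, H u -> H v -> H (lmul u v) &
      forall u, H u -> H (linv u)].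

Definition inner_product ip : Prop :=
  [/\ forall a X Y Z, ip (a *: X + Y) Z = a * ip X Z + ip Y Z,
      forall X Y, ip X Y = ip Y X &
      forall X, X != 0 -> 0 < ip X X].

(* The pull-back of ip, seen as a constant metric on the Lie algebra, by log. *)
Definition log_euclidean_metric ip : metric_tensor G :=
  fun u X Y =>
    let dlog := mdiff (N := model_space lie) (@logG R G) u in
    ip (dlog X) (dlog Y).

Section CanonicalSection.
Variables (ip : lie -> lie -> R) (H : set G).

Definition log_subgroup : set lie := @logG R G @` H.

Definition orth_compl : set lie :=
  [set X | forall Y, log_subgroup Y -> ip X Y = 0].

(* G/H and Lie(G)/Lie(H) are taken as sets of cosets. *)
Definition coset u : set G := [set lmul u h | h in H].

Definition lin_coset (X : lie) : set lie := [set X + Y | Y in log_subgroup].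

Definition lin_section : set lie -> lie := 'pinv_(fun=> 0) orth_compl lin_coset.

(* By [log_coset] below, log maps the coset of p onto log p + log H. *)
Definition canonical_section (C : set G) : G :=
  expG (lin_section (@logG R G @` C)).

Definition section_image : set G := canonical_section @` range coset.

Lemma log_coset u : @logG R G @` coset u = lin_coset (logG u).
Proof.
apply/seteqP; split => [_ [_ [h Hh <-] <-]|_ [_ [h Hh <-] <-]].
  by exists (logG h); [exists h | rewrite expGK].
by exists (lmul u h); [exists h | rewrite expGK].
Qed.

Lemma canonical_sectionE u :
  canonical_section (coset u) = expG (lin_section (lin_coset (logG u))).
Proof. by rewrite /canonical_section log_coset. Qed.

End CanonicalSection.

(* The tangent spaces at h * k of the two leaves H * k and h * K are required
   to be orthogonal. *)
Definition orthogonal_direct_product (g : metric_tensor G) H K : Prop :=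
  [/\ subgroup H, subgroup K, H `&` K = [set lone],
      forall u, exists h k, [/\ H h, K k & u = lmul h k] &
      forall h k X Y, H h -> K k -> tangent H h X -> tangent K k Y ->
        g (lmul h k) (mdiff (fun u => lmul u k) h X)
                     (mdiff (fun v => lmul h v) k Y) = 0].

End LogEuclidean.

(* Main.v *)
From HB Require Import structures.
Require Import Defs.
From mathcomp Require Import all_boot all_order all_algebra.
From mathcomp Require Import all_classical all_reals all_analysis.

(** In the global chart log, G is the vector space Lie(G) with its addition and
    a constant metric. A closed connected additive subgroup of a
    finite-dimensional space is a linear subspace W: modulo the union of the
    lines it contains it is discrete, since normalized small elements of the
    subgroup accumulate at directions of such lines. So log H = W, the image of
    the canonical section is the exponential of the orthogonal complement W' of
    W, and in log coordinates Phi is the addition W * W' -> Lie(G), whose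
    inverse is given by the two linear projections. Along a curve of H * K,
    log o Phi is the sum of a curve in W and a curve in W', so the cross terms
    of the metric vanish. *)

Set Implicit Arguments.
Unset Strict Implicit.
Unset Printing Implicit Defensive.

Import Order.TTheory GRing.Theory Num.Theory.
Import numFieldNormedType.Exports VectorInternalTheory.

Local Open Scope classical_set_scope.
Local Open Scope ring_scope.

(** * Functions of class C^k *)

Section Calculus.
Context {R : realType}.
Implicit Types V W X : normedModType R.

(** Functions that agree near [x] share their first-order expansions there, and the continuous
    linear part of such an expansion is unique. *)
Lemma near_eq_diff V W (f g : V -> W) (x : V) :
  (\near x, f x = g x) -> differentiable f x ->
  differentiable g x /\ 'd g x = 'd f x :> (V -> W).
Proof.
move=> fg df.
have E : g \o shift x = cst (g x) + 'd f x +o_ 0 id.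
  apply/eqaddoE/eqaddoP => _/posnumP[e].
  have /eqaddoP/(_ e%:num) := diff_locally df.
  have fg0 : \forall h \near (0 : V), f (h + x) = g (h + x).
    by move: fg; rewrite (near_shift 0 x); apply: filterS => h;
      rewrite /= subr0.
  move=> /(_ (gt0 e)); apply: filterS2 fg0 => h fgh.
  by rewrite !fctE /= fgh (nbhs_singleton fg).
have cd := diff_continuous df.
have dE : 'd g x = 'd f x :> (V -> W) by apply: diff_unique.
by split=> //; apply/diff_locallyP; rewrite dE.
Qed.

Lemma open_near_eq V W (U : set V) (f g : V -> W) x :
  open U -> {in U, f =1 g} -> U x -> \near x, f x = g x.
Proof.
move=> oU fg Ux; apply: filterS (open_nbhs_nbhs (conj oU Ux)) => y Uy.
by apply: fg; rewrite inE.
Qed.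

Lemma CkS k V W (U U' : set V) (f : V -> W) :
  U' `<=` U -> Ck k U f -> Ck k U' f.
Proof.
move=> sU; elim: k f => [|k IH] f /=; first by move=> cf x /sU; exact: cf.
by move=> [df cf]; split=> [x /sU|v]; [exact: df|exact/IH/cf].
Qed.

Lemma Ck_continuous k V W (U : set V) (f : V -> W) :
  Ck k U f -> forall x, U x -> {for x, continuous f}.
Proof.
by case: k => //= k [df _] x /df; exact: differentiable_continuous.
Qed.

Lemma CkW k V W (U : set V) (f : V -> W) : Ck k.+1 U f -> Ck k U f.
Proof.
elim: k f => [|k IH] f; first exact: Ck_continuous.
by move=> [df cf]; split=> // v; apply/IH/cf.
Qed.

(** As [U] is open, equality on [U] is equality near each of its points, which is what derivatives
    see. *)
Lemma eq_Ck k V W (U : set V) (f g : V -> W) :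
  open U -> {in U, f =1 g} -> Ck k U f -> Ck k U g.
Proof.
move=> oU; elim: k f g => [|k IH] f g fg /=.
  move=> cf x Ux; have nfg := open_near_eq oU fg Ux.
  rewrite /prop_for /continuous_at -(nbhs_singleton nfg).
  by apply: cvg_trans (cf x Ux); exact: near_eq_cvg.
move=> [df cf]; split=> [x Ux|v].
  by have [] := near_eq_diff (open_near_eq oU fg Ux) (df x Ux).
apply: IH (cf v) => x; rewrite inE => Ux.
exact: near_eq_derive (open_near_eq oU fg Ux).
Qed.

(** [Ck] imposes conditions at single points on the iterated derivatives of a total function, so it
    can be checked point by point. *)
Lemma Ck_local k V W (U : set V) (f : V -> W) :
  (forall x, U x -> exists2 U', U' x & Ck k U' f) -> Ck k U f.
Proof.
elim: k f => [|k IH] f Uf /=.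
  by move=> x /Uf[U' U'x /(_ _ U'x)].
split=> [x /Uf[U' U'x [/(_ _ U'x)]] //|v]; apply: IH => x /Uf[U' U'x [_ cf]].
by exists U'; [|exact: cf].
Qed.

Lemma Ck_cst k V W (U : set V) (a : W) : Ck k U (fun=> a).
Proof.
elim: k a => [|k IH] a /=; first by move=> x _; exact: cvg_cst.
split=> [x _|v]; first exact: differentiable_cst.
rewrite (_ : 'D_v _ = fun=> 0); first exact: IH.
by apply/funext => x; exact: derive_cst.
Qed.

(** On [U] the chain rule gives ['D_v (L \o f) = L \o 'D_v f], so the induction runs over [f] with
    [L] fixed. *)
Lemma Ck_linl k V W X (U : set V) (f : V -> W) (L : {linear W -> X}) :
  continuous L -> open U -> Ck k U f -> Ck k U (L \o f).
Proof.
move=> cL oU; elim: k f => [|k IH] f /=.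
  by move=> cf x Ux; apply: continuous_comp; [exact: cf|exact: cL].
move=> [df cf]; split=> [x Ux|v].
  by apply: differentiable_comp; [exact: df|exact: linear_differentiable].
apply: eq_Ck (IH _ (cf v)) => // x; rewrite inE => Ux /=.
have dL := linear_differentiable (f x) cL.
have dLf : differentiable (L \o f) x by apply: differentiable_comp (df _ Ux) dL.
rewrite (deriveE _ dLf) (deriveE _ (df _ Ux)) (diff_comp (df _ Ux) dL) /=.
by rewrite diff_lin.
Qed.

Lemma Ck_linr k V W X (U : set W) (f : W -> X) (L : {linear V -> W}) :
  continuous L -> Ck k U f -> Ck k (L @^-1` U) (f \o L).
Proof.
move=> cL; elim: k f => [|k IH] f /=.
  by move=> cf x Ux; apply: continuous_comp; [exact: cL|exact: cf].
move=> [df cf]; split=> [x Ux|v].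
  by apply: differentiable_comp; [exact: linear_differentiable|exact: df].
(* Both sides are limits of the same difference quotients, so this is an identity of total
   functions. *)
rewrite (_ : 'D_v _ = 'D_(L v) f \o L); first exact/IH/cf.
apply/funext => x; rewrite /derive /=.
by under eq_fun do rewrite linearP.
Qed.

Lemma Ck_id k V (U : set V) : Ck k U (@id V).
Proof.
case: k => [|k] /=; first by move=> x _; exact: cvg_id.
split=> [x _|v]; first exact: ex_diff.
rewrite (_ : 'D_v _ = fun=> v); first exact: Ck_cst.
by apply/funext => x; rewrite derive_id.
Qed.

Lemma CkD k V W (U : set V) (f g : V -> W) :
  open U -> Ck k U f -> Ck k U g -> Ck k U (fun x => f x + g x).
Proof.
move=> oU; elim: k f g => [|k IH] f g /=.
  by move=> cf cg x Ux; apply: continuousD; [exact: cf|exact: cg].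
move=> [df cf] [dg cg]; split=> [x Ux|v].
  by apply: differentiableD; [exact: df|exact: dg].
apply: eq_Ck (IH _ _ (cf v) (cg v)) => // x; rewrite inE => Ux /=.
by rewrite -deriveD //; apply: diff_derivable; [exact: df|exact: dg].
Qed.

Lemma Ck_sum k V W (U : set V) n (f : 'I_n -> V -> W) :
  open U -> (forall i, Ck k U (f i)) -> Ck k U (fun x => \sum_i f i x).
Proof.
move=> oU; elim: n f => [|n IH] f cf.
  by under eq_fun do rewrite big_ord0; exact: Ck_cst.
under eq_fun do rewrite big_ord_recl.
by apply: CkD => //; apply: IH.
Qed.

Lemma scale_is_bilinear W : bilinear_for
  (GRing.Scale.Law.clone _ _ *:%R _) (GRing.Scale.Law.clone _ _ *:%R _)
  (@GRing.scale R W : R^o -> W -> W).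
Proof.
split=> [w|u] a x y /=; first by rewrite scalerDl scalerA.
by rewrite scalerDr !scalerA mulrC.
Qed.

(** Scaling is a continuous bilinear map once scalars are viewed in the normed module [R^o]. This is
    the source of the product rule in [CkZ]. *)
Lemma is_diff_scale W (p : R^o * W) :
  is_diff p (fun q => q.1 *: q.2) (fun q => p.1 *: q.2 + q.1 *: p.2).
Proof.
pose M := bilinear_isBilinear.Build R R^o W W _ _ _ (scale_is_bilinear W).
pose B : {bilinear R^o -> W -> W} :=
  HB.pack (@GRing.scale R W : R^o -> W -> W) M.
have cB : continuous (fun p : R^o * W => B p.1 p.2).
  by move=> q; exact: scale_continuous.
split; first exact: (@differentiable_bilin _ _ _ _ B).
exact: (@diff_bilin _ _ _ _ B).
Qed.

Lemma CkZ k V W (U : set V) (a : V -> R^o) (f : V -> W) :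
  open U -> Ck k U a -> Ck k U f -> Ck k U (fun x => a x *: f x).
Proof.
move=> oU; elim: k a f => [|k IH] a f /=.
  by move=> ca cf x Ux; apply: continuousZ; [exact: ca|exact: cf].
move=> ca cf; have [[da Da] [df Df]] := (ca, cf).
have dZ x : U x -> is_diff x (fun x => a x *: f x)
    (fun v => a x *: 'd f x v + 'd a x v *: f x).
  move=> Ux; have B := is_diff_scale (a x, f x).
  have P : is_diff x (fun y => (a y, f y)) (fun y => ('d a x y, 'd f x y)).
    by apply: is_diff_pair; apply: differentiableP; [exact: da|exact: df].
  exact: is_diff_comp.
split=> [x /dZ //|v].
apply: (@eq_Ck _ _ _ _ (fun x => a x *: 'D_v f x + 'D_v a x *: f x)) => //.
  move=> x; rewrite inE => Ux; have [dfx dax] := (df _ Ux, da _ Ux).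
  have [dax_f E] := dZ _ Ux.
  by rewrite (deriveE _ dfx) (deriveE _ dax) (deriveE _ dax_f) E.
by apply: CkD => //; apply: IH => //; apply: CkW.
Qed.

(** Finite dimension as the chain rule uses it: vectors expand with continuous linear coefficients.
    It is phrased for normed modules so as to cover both row vectors and the Lie algebra. *)
Definition has_finite_basis V := exists n (e : 'I_n -> V)
  (c : 'I_n -> {linear V -> R^o}),
  (forall i, continuous (c i)) /\ forall x, x = \sum_i c i x *: e i.

(* The chain rule expands 'D_v (f \o g) in a basis e of W as
   \sum_i (D_v g)_i *: ('D_(e i) f \o g), to which the induction hypothesis
   applies. *)
Lemma Ck_comp k V W X (U : set V) (A : set W) (f : W -> X) (g : V -> W) :
  has_finite_basis W -> open U -> open A -> (forall x, U x -> A (g x)) ->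
  Ck k A f -> Ck k U g -> Ck k U (f \o g).
Proof.
move=> [n [e [c [cc cE]]]] oU oA UA; elim: k f => [|k IH] f /=.
  by move=> cf cg x Ux; apply: continuous_comp; [exact: cg|exact/cf/UA].
move=> cf cg; have [[df Df] [dg Dg]] := (cf, cg).
have dfg x : U x -> differentiable (f \o g) x.
  by move=> Ux; apply: differentiable_comp; [exact: dg|exact/df/UA].
split=> // v; apply: (@eq_Ck _ _ _ _
    (fun x => \sum_i c i ('D_v g x) *: 'D_(e i) f (g x))) => //.
  move=> x; rewrite inE => Ux.
  have [dgx dfx] := (dg _ Ux, df _ (UA _ Ux)).
  rewrite (deriveE _ (dfg _ Ux)) (diff_comp dgx dfx) /= (deriveE _ dgx).
  rewrite [in RHS](cE ('d g x v)) linear_sum; apply: eq_bigr => i _.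
  by rewrite linearZ (deriveE _ dfx).
apply: Ck_sum => // i; apply: CkZ => //.
  exact: (Ck_linl (cc i) oU (Dg v)).
by apply: (IH ('D_(e i) f)); [exact: Df|exact: CkW].
Qed.

Definition inl0 V W (x : V) : V * W := (x, 0).
Definition inr0 V W (x : W) : V * W := (0, x).

Lemma inl0_linear V W : linear (@inl0 V W).
Proof.
by move=> a x y; rewrite /inl0; congr pair => /=; rewrite scaler0 addr0.
Qed.

Lemma inr0_linear V W : linear (@inr0 V W).
Proof.
by move=> a x y; rewrite /inr0; congr pair => /=; rewrite scaler0 addr0.
Qed.

HB.instance Definition _ V W :=
  GRing.isLinear.Build _ _ _ _ _ (@inl0_linear V W).
HB.instance Definition _ V W :=
  GRing.isLinear.Build _ _ _ _ _ (@inr0_linear V W).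

(** A pair is the sum of the images of its components under the linear injections [inl0] and
    [inr0]. *)
Lemma Ck_pair k V W X (U : set V) (f : V -> W) (g : V -> X) :
  open U -> Ck k U f -> Ck k U g -> Ck k U (fun x => (f x, g x)).
Proof.
move=> oU cf cg; rewrite (_ : (fun _ => _) =
    (fun x => inl0 X (f x) + inr0 W (g x))); last first.
  by apply/funext => x; congr pair; rewrite /= ?addr0 ?add0r.
apply: CkD => //; apply: Ck_linl => //.
  by move=> x; apply: cvg_pair => //=; exact: cvg_cst.
by move=> x; apply: cvg_pair => //=; exact: cvg_cst.
Qed.

End Calculus.

(** * Finite-dimensional spaces *)

Section FiniteDimension.
Context {R : realType}.

(** In the canonical basis the map is a finite sum of coordinates times fixed vectors. *)
Lemma rV_linear_continuous n (W : normedModType R)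
    (f : {linear 'rV[R]_n -> W}) : continuous f.
Proof.
rewrite (_ : (f : _ -> _) = fun x => \sum_i x 0 i *: f (delta_mx 0 i)).
  apply: continuous_big => [|i _ x]; first exact: add_continuous.
  by apply: continuousZr_tmp; exact: coord_continuous.
apply/funext => x; rewrite [in LHS](row_sum_delta x) linear_sum.
by apply: eq_bigr => i _; rewrite linearZ.
Qed.

Lemma rV_has_finite_basis n : has_finite_basis 'rV[R]_n.
Proof.
have lin i : linear (fun x : 'rV[R]_n => x 0 i : R^o).
  by move=> a x y; rewrite !mxE.
pose c i : {linear 'rV[R]_n -> R^o} :=
  HB.pack (fun x : 'rV[R]_n => x 0 i : R^o)
    (GRing.isLinear.Build _ _ _ _ _ (lin i)).
exists n, (delta_mx 0), c; split=> [i|x]; first exact: rV_linear_continuous.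
exact: row_sum_delta.
Qed.

Context (V : normedVectType R).
Local Notation n := (dim V).

Lemma r2v_continuous : continuous (r2v : 'rV[R]_n -> V).
Proof. exact: rV_linear_continuous. Qed.

(* Half of the equivalence of norms: the minimum over the unit sphere. *)
Lemma r2v_normge : exists2 m : R, 0 < m &
  forall x : 'rV_n, m * `|x| <= `|r2v x : V|.
Proof.
pose S := [set x : 'rV[R]_n | `|x| = 1].
(* An empty sphere means that the space is zero, and then any positive constant works. *)
have [S0|S0] := pselect (S !=set0); last first.
  exists 1 => // x; rewrite mul1r; have [->|x0] := eqVneq x 0.
    by rewrite linear0 !normr0.
  exfalso; apply: S0; exists (`|x|^-1 *: x).
  by rewrite /S /= normrZ normrV ?unitfE ?normr_eq0 // normr_id
    mulVf ?normr_eq0.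
have cS : compact S.
  apply: bounded_closed_compact.
    exists 1; split; first exact: num_real.
    by move=> M M1 x; rewrite /S /= => ->; exact: ltW.
  rewrite (_ : S = Num.norm @^-1` [set 1 : R]); last by [].
  by apply: closed_comp => [x _|]; [exact: norm_continuous|exact: closed_eq].
have [x xS min] : exists2 x, x \in S &
    forall y, y \in S -> `|r2v x : V| <= `|r2v y : V|.
    apply: (@compact_EVT_min _ R (fun x : 'rV[R]_n => `|r2v x : V|) S S0 cS).
  apply: continuous_subspaceT => x.
  by apply: continuous_comp; [exact: r2v_continuous|exact: norm_continuous].
move: xS; rewrite inE => xS; exists `|r2v x|.
  rewrite normr_gt0; apply/eqP => /(congr1 v2r).
  rewrite r2vK linear0 => x0.
  by move: xS; rewrite /S /= x0 normr0 => /eqP; rewrite eq_sym oner_eq0.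
move=> y; have [->|y0] := eqVneq y 0; first by rewrite linear0 !normr0 mulr0.
have ny : 0 < `|y| by rewrite normr_gt0.
have /min : `|y|^-1 *: y \in S.
  by rewrite inE /S /= normrZ normrV ?unitfE ?normr_eq0 // normr_id
    mulVf ?normr_eq0.
rewrite linearZ normrZ normrV ?unitfE ?normr_eq0 // normr_id.
by rewrite mulrC ler_pdivlMr.
Qed.

(** The lower bound [m] of [r2v_normge] makes [v2r] bounded by [m^-1]. Together with
    [r2v_continuous], coordinates form a homeomorphism. *)
Lemma v2r_continuous : continuous (v2r : V -> 'rV[R]_n).
Proof.
have [m m0 mP] := r2v_normge.
apply/linear_bounded_continuous/linear_boundedP; exists (m^-1); split.
  exact: num_real.
move=> r mr x; rewrite (le_trans _ (ler_wpM2r _ (ltW mr))) //.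
by rewrite ler_pdivlMl // (le_trans (mP _)) // v2rK.
Qed.

Lemma vect_linear_continuous (W : normedModType R) (f : {linear V -> W}) :
  continuous f.
Proof.
rewrite (_ : (f : _ -> _) = (f \o r2v) \o v2r).
  move=> x; apply: continuous_comp; first exact: v2r_continuous.
  exact: rV_linear_continuous.
by apply/funext => x /=; rewrite v2rK.
Qed.

Lemma vect_has_finite_basis : has_finite_basis V.
Proof.
have [m [e [c [cc cE]]]] := rV_has_finite_basis n.
pose c' i : {linear V -> R^o} := c i \o v2r.
exists m, (r2v \o e), c'; split=> [i|x].
  exact: vect_linear_continuous.
rewrite -[LHS]v2rK [in LHS](cE (v2r x)) linear_sum.
by apply: eq_bigr => i _; rewrite linearZ.
Qed.

(** The sphere is closed and lies in the image of a compact ball of row vectors, whose radius [m^-1]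
    comes from [r2v_normge]. *)
Lemma vect_sphere_compact : compact [set x : V | `|x| = 1].
Proof.
have [m m0 mP] := r2v_normge.
pose B := [set x : 'rV[R]_n | `|x| <= m^-1].
have cB : compact B.
  apply: bounded_closed_compact.
    exists (m^-1); split; first exact: num_real.
    by move=> M M1 x Bx; exact: le_trans Bx (ltW M1).
  rewrite (_ : B = Num.norm @^-1` [set x : R | x <= m^-1]); last by [].
  by apply: closed_comp => [x _|]; [exact: norm_continuous|exact: closed_le].
apply: (@subclosed_compact _ _ (r2v @` B)).
- rewrite (_ : [set _ | _] = (Num.norm : V -> R) @^-1` [set 1 : R]); last by [].
  by apply: closed_comp => [x _|]; [exact: norm_continuous|exact: closed_eq].
- apply: continuous_compact => //; apply: continuous_subspaceT.
  exact: r2v_continuous.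
- move=> x /= x1; exists (v2r x); last exact: v2rK.
  rewrite /B /= -[leRHS]mulr1 ler_pdivlMl // -x1.
  by rewrite (le_trans (mP _)) // v2rK.
Qed.

End FiniteDimension.

(** * Closed subgroups and orthogonal complements *)

Section ClosedSubgroups.
Context {R : realType} (V : normedVectType R).

(** Take [W] of maximal dimension inside [L]: a vector [x] of [L] outside [W] would give the larger
    space [W + <[x]>], still inside [L]. *)
Lemma linear_subspace_vspace (L : set V) :
  linear_subspace L -> exists W : {vspace V}, L = [set` W].
Proof.
move=> [L0 Llin].
pose P d := `[< exists2 W : {vspace V}, [set` W] `<=` L & \dim W = d >].
have P0 : exists d, P d.
  exists 0; apply/asboolP; exists 0%VS; last exact: dimv0.
  by move=> x /=; rewrite memv0 => /eqP ->.
have Pmax d : P d -> (d <= dim V)%N.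
  by move=> /asboolP[W _ <-]; rewrite -dimvf dimvS // subvf.
have [d /asboolP[W WL dW] dmax] := ex_maxnP P0 Pmax.
exists W; apply/seteqP; split=> // x Lx.
have dmx : P (\dim (W + <[x]>)).
  apply/asboolP; exists (W + <[x]>)%VS => // y /= /memv_addP[w Ww [z]].
  move=> /vlineP[a ->] ->; rewrite addrC.
  by apply: Llin => //; exact: WL.
have /eqP E : W == (W + <[x]>)%VS by rewrite eqEdim addvSl dW dmax.
have : 0 + x \in (W + <[x]>)%VS.
  by apply: memv_add; [exact: mem0v|exact: memv_line].
by rewrite add0r -E.
Qed.

(** [W] is the set of fixed points of the continuous projection [projv W]. *)
Lemma vspace_closed (W : {vspace V}) : closed [set` W].
Proof.
have cp : continuous (projv W) by exact: vect_linear_continuous.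
rewrite (_ : [set` W] = (fun x => projv W x - x) @^-1` [set 0]).
  apply: closed_comp; last first.
    exact/accessible_closed_set1/hausdorff_accessible/norm_hausdorff.
  by move=> x _; apply: cvgB; [exact: cp|exact: cvg_id].
apply/seteqP; split=> x /= => [Wx|/eqP]; first by rewrite projv_id ?subrr.
by rewrite subr_eq0 => /eqP <-; exact: memv_proj.
Qed.

Section Subgroup.
Variable A : set V.
Hypotheses (A0 : A 0) (AD : forall x y, A x -> A y -> A (x + y))
  (AN : forall x, A x -> A (- x)).

Lemma subgroup_mulrz (m : int) x : A x -> A (x *~ m).
Proof.
move=> Ax; have Apos n : A (x *+ n).
  by elim: n => [|n IH]; rewrite ?mulr0n // mulrS; exact: AD.
by case: m => n; [exact: Apos|exact/AN/Apos].
Qed.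

(** This is the largest linear subspace contained in the subgroup [A]. *)
Definition lines : set V := [set x | forall t, A (t *: x)].

Lemma lines_linear : linear_subspace lines.
Proof.
split=> [t|a x y Lx Ly t]; first by rewrite scaler0.
by rewrite scalerDr scalerA; apply: AD.
Qed.

(* With m the integer part of t / |u n|, the element (u n) *~ m of A is close to
   t *: v when u n is small and has a direction close to v. *)
Lemma closed_subgroup_line (u : nat -> V) (v : V) : closed A ->
  (forall n, [/\ A (u n), u n != 0 & `|u n| < n.+1%:R^-1]) ->
  cluster ((fun n => `|u n|^-1 *: u n) @ \oo) v -> lines v.
Proof.
move=> cA uP vc t; apply: cA => B /nbhs_normP[e /= e0 eB].
(* The error below is [t] times the gap in direction plus a fractional part times [u n]. Each
   summand gets [e / 2]; the [+ 1] keeps the divisor positive when [t] is zero. *)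
pose e' := e / 2 / (`|t| + 1).
have t1 : 0 < `|t| + 1 by rewrite ltr_wpDl.
have e'0 : 0 < e' by rewrite !divr_gt0.
pose F := [set `|u n|^-1 *: u n | n in [set n | n.+1%:R^-1 < e / 2]].
have [_ [[n /= ne <-] vn]] : F `&` [set y | `|v - y| < e'] !=set0.
  apply: vc; last by apply/nbhs_normP; exists e'.
  have : \forall n \near \oo, n.+1%:R^-1 < e / 2.
    by apply: near_infty_natSinv_lt (PosNum (divr_gt0 e0 (ltr0Sn _ 1))).
  by apply: filterS => n ne; exists n.
have [Au u0 un] := uP n; have nu : 0 < `|u n| by rewrite normr_gt0.
pose m := Num.floor (t / `|u n|).
exists (u n *~ m); split; first exact: subgroup_mulrz.
apply: eB => /=.
have -> : t *: v - u n *~ m =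
    t *: (v - `|u n|^-1 *: u n) + (t / `|u n| - m%:~R) *: u n.
  by rewrite scalerBr scalerBl scalerA addrA subrK scaler_int.
rewrite (le_lt_trans (ler_normD _ _)) // !normrZ (splitr e) ltrD //.
  move: vn; rewrite /= ltr_pdivlMr // mulrC; apply: le_lt_trans.
  by rewrite ler_wpM2r // lerDl.
(* The fractional part is at most one, so the second summand is bounded by the norm of [u n]. *)
rewrite (le_lt_trans _ (lt_trans un ne)) // ler_piMl //.
have /andP[m1 m2] := floor_itv (t / `|u n|).
rewrite ger0_norm ?subr_ge0 //.
by move: m2; rewrite intrD => /ltW; rewrite lerBlDl.
Qed.

(** Otherwise [A] has nonzero elements in [W'] of norm tending to zero. By compactness of the sphere
    their directions cluster at a unit vector, which lies in [W] by [closed_subgroup_line] and in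
    the closed [W'], hence is zero. *)
Lemma closed_subgroup_discrete (W W' : {vspace V}) : closed A ->
  lines = [set` W] -> (W :&: W')%VS = 0%VS ->
  exists2 e : R, 0 < e & forall x, A x -> x \in W' -> `|x| < e -> x = 0.
Proof.
move=> cA LW WW'; apply: contrapT => H.
have {}H n : exists x, [/\ A x, x \in W', x != 0 & `|x| < n.+1%:R^-1].
  apply: contrapT => Hn; apply: H; exists (n.+1%:R^-1) => // x Ax W'x xn.
  by apply: contrapT => /eqP x0; apply: Hn; exists x.
have [u uP] := choice H; pose w n := `|u n|^-1 *: u n.
have [v [/= v1 vc]] : [set x : V | `|x| = 1] `&` cluster (w @ \oo) !=set0.
  have wn : \forall n \near \oo, `|w n| = 1.
    apply: nearW => n /=; have [_ _ u0 _] := uP n.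
    by rewrite /w normrZ normrV ?unitfE ?normr_eq0 // normr_id
    mulVf ?normr_eq0.
  exact: vect_sphere_compact wn.
have Wv : v \in W.
  have : lines v by apply: closed_subgroup_line vc => // n; have [] := uP n.
  by rewrite LW.
have W'v : v \in W'.
  suff : [set` W'] v by [].
  apply: (@vspace_closed W') => B Bv.
  have [_ [[n _ <-] Bn]] : (range w) `&` B !=set0.
    apply: vc => //; suff : \forall n \near \oo, range w (w n) by [].
    by apply: nearW => n; exists n.
  by exists (w n); split=> //=; rewrite memvZ //; have [] := uP n.
have : v \in (W :&: W')%VS by rewrite memv_cap Wv.
rewrite WW' memv0 => /eqP v0; move: v1; rewrite v0 normr0 => /eqP.
by rewrite eq_sym oner_eq0.
Qed.

Lemma closed_connected_subgroup_vspace : closed A -> connected A ->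
  exists W : {vspace V}, A = [set` W].
Proof.
move=> cA ctA; have [W LW] := linear_subspace_vspace lines_linear.
have WA : [set` W] `<=` A.
  by rewrite -LW => x /(_ 1); rewrite scale1r.
have WC : (W :&: W^C)%VS = 0%VS := capv_compl W.
have [e e0 eP] := closed_subgroup_discrete cA LW WC.
pose q x := x - projv W x.
have cq : continuous q.
  move=> x; apply: cvgB; first exact: cvg_id.
  exact: (@vect_linear_continuous _ V V (projv W)).
have [d d0 dP] : exists2 d, 0 < d & forall x, `|x| < d -> `|q x| < e.
  have /nbhs_normP[d /= d0 dq] : nbhs 0 [set x | `|q x| < e].
    have := cq 0; rewrite /continuous_at /q linear0 subr0 => q0.
    have /q0 : nbhs (0 : V) [set x | `|x| < e].
      by apply/nbhs_normP; exists e => //= x /=; rewrite sub0r normrN.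
    by [].
  by exists d => // x xd; apply: dq; rewrite /= sub0r normrN.
(* For [x] in [A], [q x] is again in [A] because [W] lies in [A]. It is also in the complement of
   [W] and short, hence zero. *)
have near0 x : A x -> `|x| < d -> x \in W.
  move=> Ax xd; have Wp : projv W x \in W := memv_proj W x.
  have /eqP : q x = 0.
    apply: eP (dP _ xd); first by apply: AD => //; apply/AN/WA.
    exact: memv_projC.
  by rewrite subr_eq0 => /eqP ->.
(* W is nonempty and both open and closed in the connected set A. *)
exists W; apply/esym/ctA.
- by exists 0; rewrite /= mem0v.
(* If [x] in [A] is within [d] of a point [w] of [W], then [x - w] is a short element of [A], so
   [near0] puts [x] in [W]. *)
- exists (\bigcup_(w in [set` W]) ball w d).
    by apply: bigcup_open => w _; exact: ball_open.
  apply/seteqP; split=> x /=.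
    by move=> Wx; split; [exact: WA|exists x => //; exact: ballxx].
  move=> [Ax [w /= Ww]]; rewrite -ball_normE /= => wx.
  rewrite -(subrK w x) memvD // near0 //; last by rewrite distrC.
  by apply: AD => //; apply/AN/WA.
- exists [set` W]; first exact: vspace_closed.
  by rewrite setIC; apply/esym/setIidl.
Qed.

End Subgroup.
End ClosedSubgroups.

Section OrthogonalComplement.
Context {R : realFieldType} (V : vectType R) (ip : V -> V -> R).
Hypotheses (ipP : forall a X Y Z, ip (a *: X + Y) Z = a * ip X Z + ip Y Z)
  (ipC : forall X Y, ip X Y = ip Y X) (ip_gt0 : forall X, X != 0 -> 0 < ip X X).

Lemma ip0l Y : ip 0 Y = 0.
Proof.
have /eqP := ipP 1 0 0 Y.
by rewrite scaler0 addr0 mul1r addrC -subr_eq subrr => /eqP.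
Qed.

Lemma ip_suml n (a : 'I_n -> R) (X : 'I_n -> V) Y :
  ip (\sum_i a i *: X i) Y = \sum_i a i * ip (X i) Y.
Proof.
elim: n a X => [|n IH] a X; first by rewrite !big_ord0 ip0l.
by rewrite !big_ord_recl ipP IH.
Qed.

(** [W'] is the kernel of the map [f] that pairs a vector with a basis of [W]. Positivity makes [f]
    injective on [W], hence onto by dimension; so any [x] has the same image as some [w] in [W], and
    [x - w] is in [W']. *)
Lemma orthogonal_complement_vspace (W : {vspace V}) : exists W' : {vspace V},
  [/\ [set` W'] = [set X | forall Y, Y \in W -> ip X Y = 0],
      (W :&: W')%VS = 0%VS & (W + W')%VS = fullv].
Proof.
pose T (x : V) : 'rV[R]_(\dim W) := \row_i ip x (vbasis W)`_i.
have linT : linear T by move=> a x y; apply/rowP => i; rewrite !mxE ipP.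
pose f := linfun
  (HB.pack T (GRing.isLinear.Build _ _ _ _ T linT) : {linear V -> _}).
have kerE x : x \in lker f <-> forall Y, Y \in W -> ip x Y = 0.
  rewrite memv_ker lfunE /=; split=> [/eqP Tx Y YW|xW].
    rewrite (coord_vbasis YW) ipC ip_suml big1 // => i _.
    by move/rowP : Tx => /(_ i); rewrite !mxE ipC => ->; rewrite mulr0.
  by apply/eqP/rowP => i; rewrite !mxE xW // vbasis_mem // mem_nth ?size_tuple.
have cap0 : (W :&: lker f)%VS = 0%VS.
  apply/eqP; rewrite -subv0; apply/subvP => x; rewrite memv_cap => /andP[xW].
  move=> /kerE/(_ _ xW) xx; rewrite memv0; apply: contraT => /ip_gt0.
  by rewrite xx ltxx.
exists (lker f); split=> //.
  by apply/seteqP; split=> x /= /kerE.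
apply/vspaceP => x; rewrite memvf.
have : f x \in (f @: W)%VS.
  suff -> : (f @: W)%VS = fullv by exact: memvf.
  by apply/eqP; rewrite eqEdim subvf limg_dim_eq // dimvf /dim /= mul1n.
move=> /memv_imgP[w wW fxw]; rewrite -(subrKC w x); apply: memv_add => //.
by rewrite memv_ker linearB /= fxw subrr.
Qed.

End OrthogonalComplement.

(** * Smooth maps between manifolds *)

Lemma open_setX (T U : topologicalType) (A : set T) (B : set U) :
  open A -> open B -> open (A `*` B).
Proof.
move=> oA oB; rewrite (_ : A `*` B = fst @^-1` A `&` snd @^-1` B) //.
apply: openI; apply: open_comp => // x _; [exact: cvg_fst|exact: cvg_snd].
Qed.

Section Manifolds.
Context {R : realType}.

(** The clauses of [smooth_manifold] on single charts, on which the calculus of smooth maps rests;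
    they are established for model spaces and products too. *)
Definition charted (E : normedModType R) (M : chartedSpace E) : Prop :=
  (forall c, atlas (c : chart M E) -> is_chart c) /\
  forall p : M, atlas (chart_at p) /\ chart_dom (chart_at p) p.

Lemma smooth_manifold_charted (E : normedModType R) (M : chartedSpace E) :
  smooth_manifold M -> charted M.
Proof. by case. Qed.

Lemma model_space_charted (E : normedModType R) : charted (model_space E).
Proof.
split=> // c ->; split=> //=; try (by move=> ? _; exact: cvg_id).
- exact: openT.
- by rewrite image_id; exact: openT.
Qed.

Lemma prod_space_charted (E F : normedModType R) (M : chartedSpace E)
  (N : chartedSpace F) : charted M -> charted N -> charted (prod_space M N).
Proof.
move=> [cM aM] [cN aN]; split=> [e [c [d [ac ad ->]]]|p].
  have [[oc oc' cK cc cc'] [od od' dK dc dc']] := (cM c ac, cN d ad).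
  have imE : prod_chart c d @` chart_dom (prod_chart c d) =
      (c @` chart_dom c) `*` (d @` chart_dom d).
    apply/seteqP; split=> [_ [[x y] /= [cx dy] <-]|].
      by split=> /=; [exists x|exists y].
    by move=> [_ _] /= [[x cx <-] [y dy <-]]; exists (x, y).
  split.
  - exact: open_setX.
  - by rewrite imE; exact: open_setX.
  - by move=> [x y] /= [cx dy] /=; rewrite cK // dK.
  - move=> [x y] /= [cx dy]; apply: cvg_pair => /=.
      by apply: (cvg_comp fst c cvg_fst); exact: cc.
    by apply: (cvg_comp snd d cvg_snd); exact: dc.
  - rewrite imE => -[x y] /= [cx dy]; apply: cvg_pair => /=.
      by apply: (cvg_comp fst (chart_inv c) cvg_fst); exact: cc'.
    by apply: (cvg_comp snd (chart_inv d) cvg_snd); exact: dc'.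
have [[a1 d1] [a2 d2]] := (aM p.1, aN p.2).
by split; [exists (chart_at p.1), (chart_at p.2)|].
Qed.

(** * Composition of smooth maps and the chain rule *)

Section Composition.
Context (E F X : normedModType R) (M : chartedSpace E) (N : chartedSpace F)
  (Q : chartedSpace X).
Hypotheses (chM : charted M) (chN : charted N).

(** By continuity [f] maps a neighbourhood of [p] into the domain of [e], where [chart_inv e]
    cancels [e]. This allows [e] to be inserted in the middle of a composite. *)
Lemma chart_comp_near (f : M -> N) p (c : chart M E) (e : chart N F) :
  atlas c -> atlas e -> chart_dom c p -> chart_dom e (f p) ->
  {for p, continuous f} ->
  \forall y \near c p,
    chart_inv e ((e \o f \o chart_inv c) y) = f (chart_inv c y).
Proof.
move=> /(proj1 chM)[oc oc' cK cc cc'] /(proj1 chN)[oe oe' eK ec ec'] cp efp fc.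
have {}cc' : {for c p, continuous (chart_inv c)} by apply: cc'; exists p.
have fic : f (chart_inv c y) @[y --> c p] --> f p.
  rewrite -{2}(cK p cp); apply: continuous_comp => //.
  by rewrite cK.
have : \forall y \near c p, chart_dom e (f (chart_inv c y)).
  exact: fic _ (open_nbhs_nbhs (conj oe efp)).
by apply: filterS => y /eK.
Qed.

(** With the preferred chart at [f p] inserted, the reading of [g \o f] is near [c p] the composite
    of two readings, to which [Ck_comp] applies. *)
Lemma smooth_at_comp (f : M -> N) (g : N -> Q) p : has_finite_basis F ->
  smooth_at f p -> smooth_at g (f p) -> smooth_at (g \o f) p.
Proof.
move=> bF [fc fs] [gc gs]; split; first exact: continuous_comp.
move=> c d ac ad cp dgfp; have [ae efp] := proj2 chN (f p).
pose e := chart_at (f p).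
have [U oU Uf] := fs c e ac ae cp efp.
have [B oB Bg] := gs e d ae ad efp dgfp.
have efic : {for c p, continuous (e \o f \o chart_inv c)}.
  by apply: (Ck_continuous (Uf 0)); exact: (proj2 oU).
have cK : chart_inv c (c p) = p by have [_ _ ->] := proj1 chM c ac.
have nB : \forall y \near c p, B ((e \o f \o chart_inv c) y).
  by apply: efic; rewrite /= cK; exact: open_nbhs_nbhs.
have nK := chart_comp_near ac ae cp efp fc.
have nU := open_nbhs_nbhs oU.
have [U' oU' U'P] : exists2 U', open_nbhs (c p) U' & U' `<=` [set y |
    [/\ U y, B ((e \o f \o chart_inv c) y) &
      chart_inv e ((e \o f \o chart_inv c) y) = f (chart_inv c y)]].
  suff : nbhs (c p) [set y | [/\ U y, B ((e \o f \o chart_inv c) y) &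
      chart_inv e ((e \o f \o chart_inv c) y) = f (chart_inv c y)]].
    by rewrite nbhsE => -[U' ? ?]; exists U'.
  by apply: filterS3 nU nB nK.
exists U' => // k.
apply: (@eq_Ck _ _ _ _ _ ((d \o g \o chart_inv e) \o (e \o f \o chart_inv c))).
- exact: (proj1 oU').
- by move=> y; rewrite inE => /U'P[_ _ /= ->].
- apply: (Ck_comp bF (proj1 oU') (proj1 oB)) => //.
    by move=> y /U'P[].
  by apply: CkS (Uf k) => y /U'P[].
Qed.

Lemma smooth_at_differentiable (f : M -> N) p : smooth_at f p ->
  differentiable (chart_at (f p) \o f \o chart_inv (chart_at p)) (chart_at p p).
Proof.
move=> [_ fs]; have [ac cp] := proj2 chM p; have [ae ep] := proj2 chN (f p).
have [U [oU Up] /(_ 1%N) [Uf _]] := fs _ _ ac ae cp ep.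
exact: Uf.
Qed.

End Composition.

(** Both factors are read in the same preferred chart at [f p], so this is the chain rule in the
    model spaces, up to equality near the base point. *)
Lemma mdiff_comp (E F X : normedModType R) (M : chartedSpace E)
    (N : chartedSpace F) (Q : chartedSpace X) (f : M -> N) (g : N -> Q) p :
  charted M -> charted N -> charted Q -> smooth_at f p -> smooth_at g (f p) ->
  mdiff (g \o f) p = mdiff g (f p) \o mdiff f p.
Proof.
move=> chM chN chQ sf sg.
have [[ac cp] [ae ep]] := (proj2 chM p, proj2 chN (f p)).
have df := smooth_at_differentiable chM chN sf.
have dg := smooth_at_differentiable chN chQ sg.
have nK := chart_comp_near chM chN ac ae cp ep (proj1 sf).
have cK : chart_inv (chart_at p) (chart_at p p) = p.
  by have [_ _ ->] := proj1 chM _ ac.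
pose u := chart_at (f p) \o f \o chart_inv (chart_at p).
pose v := chart_at (g (f p)) \o g \o chart_inv (chart_at (f p)).
have uE : u (chart_at p p) = chart_at (f p) (f p) by rewrite /u /= cK.
have dv : differentiable v (u (chart_at p p)) by rewrite uE.
pose w := chart_at (g (f p)) \o (g \o f) \o chart_inv (chart_at p).
have vuw : \forall y \near chart_at p p, (v \o u) y = w y.
  by apply: filterS nK => y yK; rewrite /v /w /= yK.
have [_ E1] := near_eq_diff vuw (differentiable_comp df dv).
by rewrite /mdiff -uE E1 (diff_comp df dv).
Qed.

(** * Constants, sums, linear maps, and maps from or to products *)

Section Constructions.
Context (E F X : normedModType R) (M : chartedSpace E) (N : chartedSpace F)
  (Q : chartedSpace X).

Lemma smooth_at_cst (a : F) p :
  smooth_at (N := model_space F) (fun _ : M => a) p.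
Proof.
split=> [|c d _ -> _ _]; first exact: cvg_cst.
exists setT; first by split=> //; exact: openT.
by move=> k; exact: Ck_cst.
Qed.

Lemma smooth_atD (f g : M -> model_space F) p :
  smooth_at f p -> smooth_at g p ->
  smooth_at (N := model_space F) (fun x => f x + g x : F) p.
Proof.
move=> [fc fs] [gc gs]; split=> [|c d ac -> cp _].
  exact: (@continuousD _ F _ (f : M -> F) (g : M -> F)).
have [U [oU Up] Uf] := fs c (id_chart F) ac erefl cp I.
have [U' [oU' Up'] Ug] := gs c (id_chart F) ac erefl cp I.
exists (U `&` U') => [|k]; first by split; [exact: openI|].
apply: CkD; first exact: openI.
  by apply: CkS (Uf k) => ? [].
by apply: CkS (Ug k) => ? [].
Qed.

Lemma smooth_at_linear (L : {linear E -> F}) x : continuous L ->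
  smooth_at (M := model_space E) (N := model_space F) L x.
Proof.
move=> cL; split=> [|_ _ -> -> _ _]; first exact: cL.
exists setT => [|k]; first by split=> //; exact: openT.
by apply: (Ck_linl (f := id) cL openT); exact: Ck_id.
Qed.

Lemma smooth_at_fstr (f : M -> Q) (p : prod_space M N) :
  smooth_at f p.1 -> smooth_at (f \o fst : prod_space M N -> Q) p.
Proof.
move=> [fc fs]; split=> [|_ d [c [c' [ac _ ->]]] ad [cp _] dp].
  by apply: continuous_comp => //; exact: cvg_fst.
have [U [oU Up] Uf] := fs c d ac ad cp dp.
exists (fst @^-1` U) => [|k].
  by split=> //; apply: open_comp => // ? _; exact: cvg_fst.
exact: (Ck_linr (L := fst : {linear (E * F)%type -> E}) (fun=> cvg_fst) (Uf k)).
Qed.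

Lemma smooth_at_sndr (f : N -> Q) (p : prod_space M N) :
  smooth_at f p.2 -> smooth_at (f \o snd : prod_space M N -> Q) p.
Proof.
move=> [fc fs]; split=> [|_ d [c [c' [_ ac ->]]] ad [_ cp] dp].
  by apply: continuous_comp => //; exact: cvg_snd.
have [U [oU Up] Uf] := fs c' d ac ad cp dp.
exists (snd @^-1` U) => [|k].
  by split=> //; apply: open_comp => // ? _; exact: cvg_snd.
exact: (Ck_linr (L := snd : {linear (E * F)%type -> F}) (fun=> cvg_snd) (Uf k)).
Qed.

(** A chart of [M] is completed to one of the product by the preferred chart at the second component
    of [f p]; then [fst] is linear on the model spaces. *)
Lemma smooth_at_fstl (f : Q -> prod_space M N) p : charted N ->
  smooth_at f p -> smooth_at (fst \o f : Q -> M) p.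
Proof.
move=> chN [fc fs]; split=> [|c d ac ad cp dp].
  by apply: continuous_comp => //; exact: cvg_fst.
have [ae ep] := proj2 chN (f p).2.
have [||U oU Uf] := fs c (prod_chart d (chart_at (f p).2)) ac _ cp.
- by exists d, (chart_at (f p).2).
- by [].
exists U => // k.
exact: (Ck_linl (L := fst : {linear (E * F)%type -> E}) (fun=> cvg_fst)
  (proj1 oU) (Uf k)).
Qed.

Lemma smooth_at_sndl (f : Q -> prod_space M N) p : charted M ->
  smooth_at f p -> smooth_at (snd \o f : Q -> N) p.
Proof.
move=> chM [fc fs]; split=> [|c d ac ad cp dp].
  by apply: continuous_comp => //; exact: cvg_snd.
have [ae ep] := proj2 chM (f p).1.
have [||U oU Uf] := fs c (prod_chart (chart_at (f p).1) d) ac _ cp.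
- by exists (chart_at (f p).1), d.
- by [].
exists U => // k.
exact: (Ck_linl (L := snd : {linear (E * F)%type -> F}) (fun=> cvg_snd)
  (proj1 oU) (Uf k)).
Qed.

Lemma smooth_at_pair (f : Q -> M) (g : Q -> N) p :
  smooth_at f p -> smooth_at g p ->
  smooth_at (fun q => (f q, g q) : prod_space M N) p.
Proof.
move=> [fc fs] [gc gs]; split=> [|c _ ac [d [e [ad ae ->]]] cp [dp ep]].
  exact: cvg_pair.
have [U [oU Up] Uf] := fs c d ac ad cp dp.
have [U' [oU' Up'] Ug] := gs c e ac ae cp ep.
exists (U `&` U') => [|k]; first by split; [exact: openI|].
apply: Ck_pair; first exact: openI.
  by apply: CkS (Uf k) => ? [].
by apply: CkS (Ug k) => ? [].
Qed.

End Constructions.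

(** The preferred charts of a product are the products of the preferred charts, so differentials are
    taken componentwise. *)
Lemma velocity_pair (E F : normedModType R) (M : chartedSpace E)
    (N : chartedSpace F) (gamma : R -> prod_space M N) :
  charted M -> charted N ->
  smooth_at (M := model_space R) gamma 0 ->
  velocity gamma =
  (velocity (fst \o gamma : R -> M), velocity (snd \o gamma : R -> N)).
Proof.
move=> chM chN sg.
have chR := model_space_charted R.
have d1 := smooth_at_differentiable chR chM (smooth_at_fstl chN sg).
have d2 := smooth_at_differentiable chR chN (smooth_at_sndl chM sg).
by have := diff_pair d1 d2 => /(congr1 (@^~ 1)).
Qed.

End Manifolds.

(** * Log-Euclidean groups *)

Lemma induced_metricE (R : realType) (E : normedModType R) (M : chartedSpace E)
    (A : set M) (g : metric_tensor M) p X Y :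
  A p -> tangent A p X -> tangent A p Y -> induced_metric A g p X Y = g p X Y.
Proof. by move=> Ap tX tY; rewrite /induced_metric asboolT. Qed.

Section LogEuclideanGroups.
Context {R : realType} (G : logEuclideanGroup R).
Local Notation lie := (lie_alg G).
Local Notation log := (@logG R G : G -> model_space lie).
Local Notation exp := (@expG R G : model_space lie -> G).
Implicit Types W : {vspace lie}.

Lemma logG_inj : injective (@logG R G).
Proof. exact: can_inj (@logGK R G). Qed.

Lemma manifold_charted : charted G.
Proof. exact/smooth_manifold_charted/manifoldP. Qed.

Let chG := manifold_charted.
Let chL : charted (model_space lie) := model_space_charted lie.
Let chR : charted (model_space R) := model_space_charted R.
Let fG : has_finite_basis 'rV[R]_(dim lie) := rV_has_finite_basis _.
Let fL : has_finite_basis lie := vect_has_finite_basis _.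

Lemma smooth_at_log (E : normedModType R) (M : chartedSpace E) (f : M -> G) p :
  charted M -> smooth_at f p -> smooth_at (log \o f) p.
Proof. by move=> chM sf; apply: smooth_at_comp => //; exact: logG_smooth. Qed.

Lemma smooth_at_exp (E : normedModType R) (M : chartedSpace E)
    (f : M -> model_space lie) p :
  charted M -> smooth_at f p -> smooth_at (exp \o f) p.
Proof. by move=> chM sf; apply: smooth_at_comp => //; exact: expG_smooth. Qed.

(** Factoring the identity through the Lie algebra reduces this to the smoothness of [log] and
    [exp]. *)
Lemma smooth_at_id (u : G) : smooth_at (id : G -> G) u.
Proof.
have -> : (id : G -> G) = exp \o log by apply/funext => v /=; rewrite logGK.
by apply: smooth_at_exp => //; exact: logG_smooth.
Qed.

Lemma smooth_at_lmul (E : normedModType R) (M : chartedSpace E)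
    (f g : M -> G) p :
  charted M -> smooth_at f p -> smooth_at g p ->
  smooth_at (fun x => lmul (f x) (g x)) p.
Proof.
move=> chM sf sg; apply: (smooth_at_exp chM).
by apply: smooth_atD; exact: smooth_at_log.
Qed.

Lemma smooth_at_cstG (E : normedModType R) (M : chartedSpace E) (u : G) p :
  charted M -> smooth_at (fun _ : M => u) p.
Proof.
move=> chM; rewrite (_ : (fun _ => u) = exp \o (fun _ : M => log u)).
  exact/(smooth_at_exp chM)/smooth_at_cst.
by apply/funext => v /=; rewrite logGK.
Qed.

Lemma smooth_at_log_linear (L : {linear lie -> lie}) u :
  smooth_at (exp \o (L \o log) : G -> G) u.
Proof.
apply: (smooth_at_exp chG); apply: (smooth_at_comp chG chL fL).
  exact: logG_smooth.
exact/smooth_at_linear/vect_linear_continuous.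
Qed.

(** The only chart of a model space is the identity, so the velocity of [log \o s] is an ordinary
    derivative. *)
Lemma dlog_velocity (s : R -> G) : smooth_at (M := model_space R) s 0 ->
  mdiff (N := model_space lie) log (s 0) (velocity s) = 'd (log \o s) 0 1.
Proof.
move=> ss; have := mdiff_comp chR chG chL ss (logG_smooth (s 0)).
by move=> /(congr1 (@^~ 1)).
Qed.

Lemma log_curve_differentiable (s : R -> G) :
  smooth_at (M := model_space R) s 0 -> differentiable (log \o s) 0.
Proof.
move=> ss; have ls := smooth_at_log chR ss.
exact (smooth_at_differentiable chR chL ls).
Qed.

Definition exp_vspace W : set G := [set u | log u \in W].

(* Near 0 the curve log \o s is fixed by the projection onto W, hence so is its
   derivative. *)
Lemma diff_log_curve W u (s : R -> G) : curves (exp_vspace W) u s ->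
  ('d (log \o s) 0 1 : lie) \in W.
Proof.
move=> [_ ss sW]; have ds := log_curve_differentiable ss.
have cP : continuous (projv W) by exact: vect_linear_continuous.
have near_proj : \forall t \near (0 : R),
    (log \o s) t = (projv W \o (log \o s)) t.
  by apply: filterS sW => t st; rewrite /= projv_id.
have [_ <-] := near_eq_diff near_proj ds.
rewrite diff_comp //=; last exact: linear_differentiable.
by rewrite diff_lin // memv_proj.
Qed.

(** One global slice chart serves all points: [log] followed by coordinates. Its transition maps to
    a chart of the atlas are smooth because [exp] and [log] are, around each point. *)
Lemma exp_vspace_submanifold W : embedded_submanifold (exp_vspace W).
Proof.
pose c : chart G 'rV[R]_(dim lie) := Chart setT (v2r \o log) (exp \o r2v).
have cT : c @` setT = setT.
  apply/seteqP; split=> // x _; exists (exp (r2v x)) => //.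
  by rewrite /= expGK r2vK.
exists [set x | r2v x \in W].
  split=> [|a x y /= xW yW]; first by rewrite /= linear0 mem0v.
  by rewrite linearP memvD // memvZ.
move=> p pW; exists c; split; [|move=> d ad|by []|].
- split=> /=.
  + exact: openT.
  + by rewrite cT; exact: openT.
  + by move=> u _; rewrite v2rK logGK.
  + move=> u _; apply: continuous_comp; first exact: (proj1 (logG_smooth u)).
    exact: v2r_continuous.
  + move=> x _; apply: continuous_comp; first exact: r2v_continuous.
    exact: (proj1 (expG_smooth _)).
- have [od od' dK dc dc'] := proj1 chG d ad; split=> k.
    apply: Ck_local => _ [u [_ du] <-].
    have [|U [oU Uu] Uf] :=
      proj2 (expG_smooth (logG u)) (id_chart lie) d erefl ad I.
      by rewrite logGK.
    exists (r2v @^-1` U); first by rewrite /= v2rK.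
    apply: (Ck_linr (L := r2v : {linear 'rV[R]_(dim lie) -> lie}) _ (Uf k)).
    exact: r2v_continuous.
  apply: Ck_local => _ [u [_ du] <-].
  have [U [oU Uu] Uf] := proj2 (logG_smooth u) d (id_chart lie) ad erefl du I.
  exists U => //.
  apply: (Ck_linl (L := v2r : {linear lie -> 'rV[R]_(dim lie)}) _ oU (Uf k)).
  exact: v2r_continuous.
- rewrite setIT cT setIT; apply/seteqP; split=> [_ [u uW <-]|x xW] /=.
    by rewrite v2rK.
  by exists (exp (r2v x)); rewrite /exp_vspace /= expGK ?r2vK.
Qed.

(** Since [log] is a homeomorphism and a group morphism, the image of [H] is a closed connected
    additive subgroup. *)
Lemma log_subgroup_vspace (H : set G) : subgroup H -> closed H -> connected H ->
  exists W, H = exp_vspace W.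
Proof.
move=> [H1 HM HV] cH ctH.
have HE X : H (exp X) <-> (@logG R G @` H) X.
  split=> [HX|[u Hu <-]]; last by rewrite logGK.
  by exists (exp X); rewrite ?expGK.
have clog : continuous (log : G -> lie) by move=> u; have [] := logG_smooth u.
have cexp : continuous (exp : lie -> G) by move=> u; have [] := expG_smooth u.
have [|||||W WE] := @closed_connected_subgroup_vspace R lie (@logG R G @` H).
- exact/HE.
- move=> _ _ [u Hu <-] [v Hv <-]; exists (lmul u v); first exact: HM.
  by rewrite expGK.
- move=> _ [u Hu <-]; exists (linv u); first exact: HV.
  by rewrite expGK.
- rewrite (_ : _ @` _ = exp @^-1` H); last by apply/seteqP; split=> X /HE.
  by apply: closed_comp => // X _; exact: cexp.
- apply: connected_continuous_connected => //.
  exact: continuous_subspaceT.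
exists W; apply/seteqP; split=> u.
  by move=> Hu; suff : [set` W] (log u) by []; rewrite -WE; exists u.
by rewrite /exp_vspace /= => uW; rewrite -(logGK u); apply/HE; rewrite WE.
Qed.

(** * The splitting of G along a subspace and its orthogonal complement *)

Section Splitting.
Variables (ip : lie -> lie -> R) (W W' : {vspace lie}).
Hypotheses (ipP : inner_product ip)
  (W'E : [set` W'] = [set X | forall Y, Y \in W -> ip X Y = 0])
  (capWW' : (W :&: W')%VS = 0%VS) (addWW' : (W + W')%VS = fullv).
Local Notation H := (exp_vspace W).
Local Notation K := (exp_vspace W').
Local Notation P := (daddv_pi W W').
Local Notation P' := (daddv_pi W' W).

Lemma proj_add X : P X + P' X = X.
Proof. by rewrite daddv_pi_add // addWW' memvf. Qed.

Lemma proj_addl X Y : X \in W -> Y \in W' -> P (X + Y) = X /\ P' (X + Y) = Y.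
Proof.
move=> XW YW'; have capW'W : (W' :&: W)%VS = 0%VS by rewrite capvC.
have PX : P X = X by rewrite daddv_pi_id.
have PY : P' Y = Y by rewrite daddv_pi_id.
(* Cancelling [P X = X] in [proj_add] leaves [P' X = 0], and symmetrically [P Y = 0]. *)
have := proj_add X; rewrite PX -[RHS]addr0 => /addrI P'X.
have := proj_add Y; rewrite PY -[RHS]add0r => /addIr P'Y.
by rewrite !linearD /= PX PY P'X P'Y addr0 add0r.
Qed.

Lemma ip_orth X Y : X \in W -> Y \in W' -> ip X Y = 0 /\ ip Y X = 0.
Proof.
move=> XW YW'; have YX : ip Y X = 0.
  suff : [set X | forall Y, Y \in W -> ip X Y = 0] Y by apply.
  by rewrite -W'E.
by split=> //; have [_ -> _] := ipP.
Qed.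

Lemma ip_add_orth X X' Y Y' : X \in W -> X' \in W -> Y \in W' -> Y' \in W' ->
  ip (X + Y) (X' + Y') = ip X X' + ip Y Y'.
Proof.
move=> XW XW' YW YW'; have [ipL ipC _] := ipP.
have ipDl A B C : ip (A + B) C = ip A C + ip B C.
  by rewrite -[A]scale1r ipL mul1r scale1r.
have ipDr A B C : ip C (A + B) = ip C A + ip C B.
  by rewrite ipC ipDl !(ipC _ C).
rewrite ipDl !ipDr (ip_orth XW YW').1 (ip_orth XW' YW).2.
by rewrite addr0 add0r.
Qed.

(** The linear section sends the coset of [logG u] to its representative [P' (logG u)] in [W']. *)
Lemma section_image_vspace : section_image ip H = K.
Proof.
have logH : log_subgroup H = [set` W].
  apply/seteqP; split=> [_ [u uH <-] //|X XW].
  by exists (exp X); rewrite /exp_vspace /= expGK.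
have orthE : orth_compl ip H = [set` W'].
  by rewrite W'E /orth_compl logH.
have secE u : lin_section ip H (lin_coset H (logG u)) = P' (logG u).
  have P'u : orth_compl ip H (P' (logG u)) by rewrite orthE /= memv_pi.
  have cosetE : lin_coset H (P' (logG u)) = lin_coset H (logG u).
    rewrite /lin_coset logH; apply/seteqP; split=> _ [Y YW <-].
      exists (Y - P (logG u)); first by rewrite /= memvB // memv_pi.
      by rewrite -{1}(proj_add (logG u)) [P _ + _]addrC -addrA subrKC.
    exists (P (logG u) + Y); first by rewrite /= memvD // memv_pi.
    by rewrite addrA [P' _ + _]addrC proj_add.
  (* The partial inverse returns this representative because [lin_coset] is injective on [W']: two
     elements of [W'] in one coset differ by a vector of both [W] and [W']. *)
  rewrite -cosetE; apply: pinvKV; last by rewrite inE.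
  move=> X Y; rewrite !inE orthE /= => XW' YW' XY.
  have : lin_coset H Y X.
    by rewrite -XY /lin_coset logH; exists 0; rewrite /= ?mem0v ?addr0.
  rewrite /lin_coset logH => -[Z ZW /= XE].
  have : X - Y \in (W :&: W')%VS.
    by rewrite memv_cap andbC memvB //= -XE addrC addKr.
  by rewrite capWW' memv0 subr_eq0 => /eqP.
rewrite /section_image; apply/seteqP; split=> [_ [_ [u _ <-] <-]|u uK].
  by rewrite canonical_sectionE secE /exp_vspace /= expGK memv_pi.
(* An element [u] of [K] is the value of the section at its own coset, as [P'] fixes [logG u]. *)
exists (coset H u); first by exists u.
rewrite canonical_sectionE secE -[RHS]logGK; congr expG.
by have [_] := proj_addl (mem0v W) uK; rewrite add0r.
Qed.

Lemma exp_vspace_subgroup U : subgroup (exp_vspace U).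
Proof.
split=> [|u v|u]; rewrite /exp_vspace /= expGK; first exact: mem0v.
  exact: memvD.
by rewrite memvN.
Qed.

Let g := log_euclidean_metric ip.
Local Notation Phi := ((fun p => lmul p.1 p.2) : prod_space G G -> G).

Lemma lmulC : commutative (@lmul R G).
Proof. by move=> u v; rewrite /lmul addrC. Qed.

(** In log coordinates right multiplication by [v] is a translation, so a curve in [exp_vspace U]
    keeps its derivative, which lies in [U]. *)
Lemma dlog_rmul U u v X : tangent (exp_vspace U) u X ->
  mdiff (N := model_space lie) log (lmul u v) (mdiff (fun w => lmul w v) u X)
    \in U.
Proof.
move=> [s cs <-]; have [s0 ss _] := cs.
pose f' := (fun w => lmul w v : G).
have sf : smooth_at f' u.
  by apply: smooth_at_lmul => //; [exact: smooth_at_id|exact: smooth_at_cstG].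
rewrite -s0 in sf *; rewrite -/f' -/(f' (s 0)).
have fs : smooth_at (M := model_space R) (f' \o s) 0 by exact: smooth_at_comp.
have -> : mdiff f' (s 0) (velocity s) = velocity (f' \o s).
  by have /(congr1 (@^~ 1)) := mdiff_comp chR chG chG ss sf.
rewrite (dlog_velocity fs).
have -> : log \o (f' \o s) = (log \o s : R -> lie) + cst (logG v).
  by apply/funext => t; rewrite /= expGK.
rewrite diffD; [|exact: log_curve_differentiable|exact: differentiable_cst].
by rewrite /= diff_cst addr0; exact: diff_log_curve cs.
Qed.

Lemma lmul_exp_vspace_inj h k h' k' : H h -> K k -> H h' -> K k' ->
  lmul h k = lmul h' k' -> h = h' /\ k = k'.
Proof.
move=> hH kK hH' kK' /(can_inj (@expGK R G)) E.
have [] := proj_addl hH kK; have [] := proj_addl hH' kK'.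
by rewrite E => -> -> /logG_inj-> /logG_inj->.
Qed.

Lemma lmul_exp_proj u : lmul (exp (P (logG u))) (exp (P' (logG u))) = u.
Proof. by rewrite /lmul !expGK proj_add logGK. Qed.

Lemma exp_proj_subset u :
  H (exp (P (logG u))) /\ K (exp (P' (logG u))).
Proof. by rewrite /exp_vspace /= !expGK !memv_pi. Qed.

Lemma splitting_orthogonal_direct_product : orthogonal_direct_product g H K.
Proof.
split.
- exact: exp_vspace_subgroup.
- exact: exp_vspace_subgroup.
- apply/seteqP; split=> [u [uH uK]|_ ->] /=.
    have : logG u \in (W :&: W')%VS by rewrite memv_cap; apply/andP.
    by rewrite capWW' memv0 => /eqP u0; rewrite -(logGK u) u0.
  by split; rewrite /exp_vspace /= expGK mem0v.
- move=> u; have [PH PK] := exp_proj_subset u.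
  by exists (exp (P (logG u))), (exp (P' (logG u))); rewrite lmul_exp_proj.
(* By commutativity the leaf [h * K] is also a right translate, so [dlog_rmul] handles both
   leaves. *)
- move=> h k X Y hH kK tX tY.
  have YW' := dlog_rmul h tY; rewrite lmulC in YW'.
  rewrite (_ : (fun v => lmul h v) = fun v => lmul v h).
    exact: (ip_orth (dlog_rmul k tX) YW').1.
  by apply/funext => v; exact: lmulC.
Qed.

Lemma splitting_diffeomorphism :
  diffeomorphism (M := prod_space G G) (H `*` K) setT Phi.
Proof.
have chGG := prod_space_charted chG chG.
split.
- split=> [//|[h k] [h' k'] /=|u _ /=].
    rewrite !inE => -[/= hH kK] [/= hH' kK'].
    move=> /(lmul_exp_vspace_inj hH kK hH' kK').
    by move=> [-> ->].
  exists (exp (P (logG u)), exp (P' (logG u))); last exact: lmul_exp_proj.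
  by have := exp_proj_subset u.
(* [Phi] is smooth on all of [G * G], so it is its own local extension; the same holds for the
   inverse [f'] on [G]. *)
- move=> p _; exists setT, Phi; split=> // [|q _].
    by split=> //; exact: openT.
  apply: smooth_at_lmul => //.
    by apply: (smooth_at_fstr (f := id)); exact: smooth_at_id.
  by apply: (smooth_at_sndr (f := id)); exact: smooth_at_id.
pose f' (u : G) : prod_space G G := (exp (P (logG u)), exp (P' (logG u))).
exists f' => [u _|[h k] [/= hH kK]].
  exists setT, f'; split=> // [|v _]; first by split=> //; exact: openT.
  by apply: smooth_at_pair; exact: smooth_at_log_linear.
rewrite /f' /lmul expGK; have [-> ->] := proj_addl hH kK.
by rewrite !logGK.
Qed.

(** The logarithm of [Phi \o s] is the sum of the logarithms of the two components of [s], and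
    differentiation at 0 is additive. *)
Lemma splitting_curve p (s : R -> prod_space G G) :
  curves (M := prod_space G G) (H `*` K) p s ->
  [/\ curves H p.1 (fst \o s), curves K p.2 (snd \o s) &
    mdiff (N := model_space lie) log (lmul p.1 p.2)
      (velocity (Phi \o s)) =
    mdiff (N := model_space lie) log p.1 (velocity (fst \o s : R -> G)) +
    mdiff (N := model_space lie) log p.2 (velocity (snd \o s : R -> G))].
Proof.
move=> [<- ss sHK].
have s1 : smooth_at (M := model_space R) (fst \o s : R -> G) 0.
  exact: (smooth_at_fstl chG).
have s2 : smooth_at (M := model_space R) (snd \o s : R -> G) 0.
  exact: (smooth_at_sndl chG).
split; [by split=> //; apply: filterS sHK => t []..|].
have s12 : smooth_at (M := model_space R) (fun t => lmul (s t).1 (s t).2) 0.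
  exact: smooth_at_lmul.
rewrite (dlog_velocity s12) (dlog_velocity s1) (dlog_velocity s2).
rewrite (_ : log \o _ = (log \o (fst \o s) : R -> lie) + (log \o (snd \o s))).
  by rewrite diffD //; exact: log_curve_differentiable.
by apply/funext => t; rewrite /= expGK.
Qed.

Lemma curve_dlog_mem U u (s : R -> G) : curves (exp_vspace U) u s ->
  mdiff (N := model_space lie) log u (velocity s) \in U.
Proof.
move=> cs; have [<- ss _] := cs.
by rewrite (dlog_velocity ss); exact: diff_log_curve cs.
Qed.

Lemma splitting_isometry :
  riemannian_isometry (M := prod_space G G) (H `*` K)
    (prod_metric (induced_metric H g) (induced_metric K g)) setT g Phi.
Proof.
split=> [|p s t [/= pH pK] cs ct]; first exact: splitting_diffeomorphism.
have [s1 s2 sE] := splitting_curve cs; have [t1 t2 tE] := splitting_curve ct.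
have [_ ss _] := cs; have [_ st _] := ct.
rewrite /prod_metric (velocity_pair chG chG ss) (velocity_pair chG chG st) /=.
(* Tangency of the component velocities ensures that the induced metrics take the value of [g] and
   not the default 0. *)
have velT A u (r : R -> G) : curves A u r -> tangent A u (velocity r).
  by exists r.
rewrite (induced_metricE g pH (velT _ _ _ s1) (velT _ _ _ t1)).
rewrite (induced_metricE g pK (velT _ _ _ s2) (velT _ _ _ t2)).
(* The components along [H] have logarithmic velocities in [W] and those along [K] in [W'], so the
   cross terms vanish. *)
exact (etrans (f_equal2 ip sE tE) (ip_add_orth (curve_dlog_mem s1)
  (curve_dlog_mem t1) (curve_dlog_mem s2) (curve_dlog_mem t2))).
Qed.

End Splitting.

End LogEuclideanGroups.

Theorem theorem4p16 (R : realType) (G : logEuclideanGroup R)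
    (ip : lie_alg G -> lie_alg G -> R) (H : set G) :
  inner_product ip ->
  subgroup H -> closed H -> connected H ->
  let g := log_euclidean_metric ip in
  let K := section_image ip H in
  let Phi := (fun p => lmul p.1 p.2) : prod_space G G -> G in
  [/\ embedded_submanifold H,
      embedded_submanifold K,
      riemannian_isometry (M := prod_space G G) (H `*` K)
        (prod_metric (induced_metric H g) (induced_metric K g)) setT g Phi &
      orthogonal_direct_product g H K].
Proof.
move=> ipP sH cH ctH g K Phi.
have [W HE] := log_subgroup_vspace sH cH ctH.
have [ipL ipC ip0] := ipP.
have [W' [W'E cap add]] := orthogonal_complement_vspace ipL ipC ip0 W.
have KE : K = exp_vspace W' by rewrite /K HE (section_image_vspace W'E cap add).
rewrite KE HE; split.
- exact: exp_vspace_submanifold.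
- exact: exp_vspace_submanifold.
- exact: splitting_isometry ipP W'E cap add.
- exact: splitting_orthogonal_direct_product ipP W'E cap add.
Qed.
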